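(* As $n=2^{k-1}-1\to\infty$, every complete Boolean function of $n$ variables can be realized by a DNF containing $3n(1+o(1))$ literal occurrences and $n(1+o(1))$ conjunctions; moreover neither bound can be asymptotically improved, i.e. every DNF realizing a complete function of $n$ variables has at least $3n(1-o(1))$ literal occurrences (for a minimal one) and at least $n(1-o(1))$ conjunctions.
   Context: For a Boolean function $f:\{0,1\}^n\to\{0,1\}$ with exactly $k$ zeros, its zero matrix $M_f$ is the $k\times n$ $0/1$ matrix whose rows are the distinct zeros of $f$; column $i$ corresponds to the variable $x_i$. $f$ is called reduced if $M_f$ has no all-zero column, no all-one column, no two equal columns, and no column equal to the coordinatewise complement of another column. A reduced function with exactly $k$ zeros and $n=2^{k-1}-1$ variables is called complete. A DNF is a disjunction of conjunctions of literals ($x_i$ or $\bar x_i$); its rank is the total number of literal occurrences and its length is the number of conjunctions. A DNF realizes $f$ if it equals $f$ as a Boolean function. *)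

(* Defs.v *)
From HB Require Import structures.
From mathcomp Require Import all_boot all_order all_algebra.
From mathcomp Require Import boolp classical_sets reals topology normedtype sequences.

Set Implicit Arguments.
Unset Strict Implicit.
Unset Printing Implicit Defensive.

(* Points of {0,1}^n are the row vectors 'rV[bool]_n, with 1 encoded as true. *)
Definition boolfun (n : nat) := 'rV[bool]_n -> bool.

Definition zeros (n : nat) (f : boolfun n) : {set 'rV[bool]_n} :=
  [set x | ~~ f x].

(* The order of the rows is that of the enumeration of zeros f; it is
   irrelevant for the column conditions below. *)
Definition zero_matrix (n : nat) (f : boolfun n) : 'M[bool]_(#|zeros f|, n) :=
  \matrix_(r < #|zeros f|) (enum_val r : 'rV[bool]_n).

Definition reduced (n : nat) (f : boolfun n) : Prop :=
  let M := zero_matrix f in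
  [/\ forall i : 'I_n, col i M <> const_mx false,
      forall i : 'I_n, col i M <> const_mx true,
      forall i j : 'I_n, i <> j -> col i M <> col j M
    & forall i j : 'I_n, i <> j -> col i M <> map_mx negb (col j M)].

(* 0 < k excludes the value k = 0, for which k - 1 would be truncated. *)
Definition complete (k n : nat) (f : boolfun n) : Prop :=
  [/\ reduced f, #|zeros f| = k, 0 < k & n = 2 ^ (k - 1) - 1].

(* (i, true) is the literal x_i and (i, false) is its negation. *)
Definition literal (n : nat) := ('I_n * bool)%type.
Definition conjunction (n : nat) := seq (literal n).
Definition dnf (n : nat) := seq (conjunction n).

Definition eval_literal (n : nat) (x : 'rV[bool]_n) (l : literal n) : bool :=
  if l.2 then x ord0 l.1 else ~~ x ord0 l.1.
Definition eval_conjunction (n : nat) (x : 'rV[bool]_n) (c : conjunction n) :=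
  all (eval_literal x) c.
Definition eval_dnf (n : nat) (d : dnf n) (x : 'rV[bool]_n) : bool :=
  has (eval_conjunction x) d.

Definition dnf_rank (n : nat) (d : dnf n) : nat := \sum_(c <- d) size c.
Definition dnf_length (n : nat) (d : dnf n) : nat := size d.

Definition realizes (n : nat) (d : dnf n) (f : boolfun n) : Prop :=
  forall x : 'rV[bool]_n, eval_dnf d x = f x.

(* Main.v *)
Require Import Defs.
From HB Require Import structures.
From mathcomp Require Import all_boot all_order all_algebra.
From mathcomp Require Import zify.

(** Let [m = k - 1].  After complementing variables so that the first zero is the
    origin, the variables are the nonempty subsets [P] of an [m]-set and the other
    zeros are the points [P |-> (r \in P)].

    Upper bound: the conjunctions [x_i x_j], [x_i ~x_[m]] and, for hypercube edges
    [(P, P + i)], [x_(P+i) ~x_P ~x_i] realize the function as soon as every proper [P]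
    is the lower end of a chosen edge and every nonempty [P] the upper end of one.
    The edges inside a partition of the cube into chains do this up to one edge at
    each end of a chain, and the Greene-Kleitman partition has only
    [C(m, m/2) = o(2^m)] chains.

    Lower bounds: flipping any variable of a zero gives a one, so at a fixed zero the
    [n] false literals lie in [n] distinct conjunctions.  For the rank, the set of zeros
    satisfying a literal has fewer than [2k/3] elements for almost all of the [2n]
    literals (second moment).  If such a literal [l] occurs only once, each other literal
    of its conjunction holds at all the zeros where [l] fails; hence the conjunction has
    at least three literals, and if two of them are of this kind all the others hold at
    more than [2k/3] zeros.  With [t] conjunctions containing such an [l] this gives
    [rank >= 3t] and [rank + t >= 4n(1 - o(1))]. *)

Set Implicit Arguments.
Unset Strict Implicit.
Unset Printing Implicit Defensive.

Import Order.TTheory GRing.Theory Num.Theory.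

(** * Chains in the Boolean lattice *)

Fixpoint words (m : nat) : seq (seq bool) :=
  if m is m'.+1 then map (cons true) (words m') ++ map (cons false) (words m')
  else [:: [::]].

Lemma size_words m : size (words m) = 2 ^ m.
Proof. by elim: m => //= m IH; rewrite size_cat !size_map IH expnS mul2n addnn. Qed.

Lemma mem_words m w : (w \in words m) = (size w == m).
Proof.
have cons_inj b : injective (cons b : seq bool -> seq bool) by move=> s t [].
elim: m w => [|m IH] [|b w] //=; rewrite mem_cat.
  by apply/orP => -[] /mapP [].
have notin c : c != b -> (b :: w \in map (cons c) (words m)) = false.
  by move=> cb; apply/mapP => -[v _ [bc _]]; rewrite bc eqxx in cb.
case: b notin => notin; rewrite mem_map // IH.
  by rewrite [X in _ || X]notin // orbF.
by rewrite notin.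
Qed.

Lemma words_uniq m : uniq (words m).
Proof.
elim: m => //= m IH; rewrite cat_uniq !map_inj_uniq ?IH /=; try by move=> s t [].
by rewrite andbT; apply/hasPn => w /mapP [v _ ->]; apply/mapP => -[].
Qed.

Definition word m (P : {set 'I_m}) : seq bool := [seq i \in P | i <- enum 'I_m].

Lemma size_word m (P : {set 'I_m}) : size (word P) = m.
Proof. by rewrite size_map size_enum_ord. Qed.

Lemma nth_word m (P : {set 'I_m}) (i : 'I_m) : nth false (word P) i = (i \in P).
Proof. by rewrite (nth_map i) ?size_enum_ord // nth_ord_enum. Qed.

Lemma word_inj m : injective (@word m).
Proof. by move=> P Q PQ; apply/setP => i; rewrite -!nth_word PQ. Qed.

Lemma perm_words m : perm_eq [seq word P | P <- enum {set 'I_m}] (words m).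
Proof.
have uw : uniq [seq word P | P <- enum {set 'I_m}].
  by rewrite map_inj_uniq ?enum_uniq //; apply: word_inj.
apply: uniq_perm => //; first exact: words_uniq.
have sub : {subset [seq word P | P <- enum {set 'I_m}] <= words m}.
  by move=> w /mapP [P _ ->]; rewrite mem_words size_word.
suff le : size (words m) <= size [seq word P | P <- enum {set 'I_m}].
  by case: (uniq_min_size uw sub le).
by rewrite size_words size_map -cardE -cardsT -powersetT card_powerset cardsT card_ord.
Qed.

(** Moves the counting of subsets to words, where recursion on the length is available. *)
Lemma card_word m (p : pred (seq bool)) :
  #|[set P : {set 'I_m} | p (word P)]| = count p (words m).
Proof.
rewrite -(permP (perm_words m)) count_map cardsE cardE size_filter -enumT.
by apply: eq_count.
Qed.

(* Reading a word from its last letter, [false] opens a bracket and [true] closes one: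
   [unmatched] counts the brackets left open, and [raise] turns the first of them into
   [true], which is the Greene-Kleitman step to the next element of the chain. *)
Fixpoint unmatched (w : seq bool) : nat :=
  if w is b :: v then (if b then (unmatched v).-1 else (unmatched v).+1) else 0.

Fixpoint raise_pos (w : seq bool) : nat :=
  if w is _ :: v then (if 0 < unmatched v then (raise_pos v).+1 else 0) else 0.

Definition raise (w : seq bool) : seq bool := set_nth false w (raise_pos w) true.

Lemma raise_cons b w :
  raise (b :: w) = if 0 < unmatched w then b :: raise w else true :: w.
Proof. by rewrite /raise /=; case: ifP. Qed.

Lemma raise_pos_lt w : 0 < unmatched w -> raise_pos w < size w.
Proof. by elim: w => //= b w IH _; case: ifP => // /IH. Qed.

Lemma nth_raise_pos w : 0 < unmatched w -> nth false w (raise_pos w) = false.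
Proof.
elim: w => //= b w IH bw; case: ifP => [/IH //|]; case: b bw => //=.
by case: (unmatched w).
Qed.

Lemma unmatched_raise w : 0 < unmatched w -> unmatched (raise w) = (unmatched w).-1.
Proof.
elim: w => // b w IH; rewrite raise_cons => bw.
case: ifP => [w0|]; first by rewrite /= IH //; case: b {bw}; case: (unmatched w) w0.
by move: bw => /=; case: b; case: (unmatched w).
Qed.

(** Suppose [raise] changes the head of [b' :: v] but a later letter of [b :: w], with equal
    results. Then [b] is [true] and [v = raise w] has no open bracket, so [w] has exactly one, which
    [b] closes; thus [b :: w] lies outside the domain. *)
Lemma raise_inj : {in [pred w | 0 < unmatched w] &, injective raise}.
Proof.
have rec (b : bool) v w : 0 < unmatched (b :: w) -> 0 < unmatched w ->
    unmatched v = 0 -> b :: raise w = true :: v -> False.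
  move=> /= + w0 v0 [b1 vE]; move: v0; rewrite -vE unmatched_raise // b1.
  by move=> ->.
elim=> [|b w IH] [|c v] //; rewrite !inE !raise_cons => bw cv.
case: ifP => [w0|/negbT w0]; case: ifP => [v0|/negbT v0].
- by move=> [-> /IH ->].
- by move/(rec _ _ _ bw w0) => []; case: (unmatched v) v0.
- by move/esym/(rec _ _ _ cv v0) => []; case: (unmatched w) w0.
- case=> ->; move: bw cv w0 v0 => /=.
  by case: b; case: c; case: (unmatched w); case: (unmatched v).
Qed.

(** Prepending a letter moves [unmatched] by one step of a walk reflected at 0, so the counts obey
    Pascal's rule. The case [j = 0] counts the tops of the chains. *)
Lemma count_unmatched m j :
  count (fun w => unmatched w == j) (words m) =
  if j <= m then 'C(m, (m - j)./2) else 0.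
Proof.
elim: m j => [|m IH] j; first by case: j.
rewrite /= count_cat !count_map.
case: j => [|j].
  rewrite [X in _ + X](@eq_count _ _ pred0) // count_pred0 addn0.
  have -> : count (preim (cons true) (fun w => unmatched w == 0)) (words m)
      = count (fun w => unmatched w == 0) (words m)
      + count (fun w => unmatched w == 1) (words m).
    rewrite -count_predUI [X in _ = _ + X](@eq_count _ _ pred0) ?count_pred0 ?addn0.
      by apply: eq_count => w /=; case: (unmatched w) => [|[]].
    by move=> w /=; case: (unmatched w) => [|[]].
  rewrite !IH !subn0 leq0n.
  have [p [->|->]] : exists p, m = p.*2 \/ m = p.*2.+1.
    by exists m./2; rewrite -{1 3}(odd_double_half m); case: (odd m); [right|left].
  - case: p => [//|p]; rewrite (_ : 0 < p.+1.*2) //.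
    have -> : (p.+1.*2 - 1)./2 = p by lia.
    have -> : p.+1.*2.+1./2 = p.+1 by lia.
    by rewrite half_double binS.
  - have -> : (p.*2.+1 - 1)./2 = p by lia.
    have -> : p.*2.+1./2 = p by lia.
    have -> : p.*2.+2./2 = p.+1 by lia.
    rewrite /= binS; congr (_ + _); rewrite -bin_sub; last by lia.
    by congr 'C(_, _); lia.
have -> : count (preim (cons true) (fun w => unmatched w == j.+1)) (words m)
    = count (fun w => unmatched w == j.+2) (words m).
  by apply: eq_count => w /=; case: (unmatched w).
have -> : count (preim (cons false) (fun w => unmatched w == j.+1)) (words m)
    = count (fun w => unmatched w == j) (words m).
  by apply: eq_count.
rewrite !IH ltnS subSS; case: (leqP j m) => jm; last by rewrite ifF //; lia.
case: ifP => jm2.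
  have -> : (m - j)./2 = (m - j.+2)./2.+1 by lia.
  by rewrite binS addnC.
have -> : (m - j)./2 = 0 by lia.
by rewrite !bin0.
Qed.

(** Squared form of the bound [4 ^ p / sqrt (2p + 1)]. The induction uses the ratio of consecutive
    central coefficients and [(2p + 1)(2p + 3) <= 4 (p + 1) ^ 2]. *)
Lemma central_bin_bound p : 'C(p.*2, p) ^ 2 * p.*2.+1 <= 16 ^ p.
Proof.
elim: p => // p IH.
have rec : p.+1 * 'C(p.+1.*2, p.+1) = 2 * p.*2.+1 * 'C(p.*2, p).
  rewrite doubleS -mul_bin_diag /= -doubleS -mul2n -!mulnA; congr (2 * _).
  have := mul_bin_down p.*2.+1 p; rewrite /= => ->; congr (_ * _); lia.
set B := 'C(p.+1.*2, p.+1) in rec *; set b := 'C(p.*2, p) in rec IH.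
rewrite -(leq_pmul2l (_ : 0 < p.+1 ^ 2)) ?expn_gt0 // mulnA -expnMn rec (expnS 16 p).
have -> : (2 * p.*2.+1 * b) ^ 2 * p.+1.*2.+1 =
  4 * (p.*2.+1 * p.+1.*2.+1) * (b ^ 2 * p.*2.+1) by lia.
apply: leq_trans (leq_mul _ IH) _; first exact: leqnn.
by rewrite [leqRHS]mulnA leq_mul2r; apply/orP; right; lia.
Qed.

Lemma middle_bin_bound m : 'C(m, m./2) ^ 2 * m.+1 <= 4 ^ m.
Proof.
have [p [->|->]] : exists p, m = p.*2 \/ m = p.*2.+1.
  by exists m./2; rewrite -{1 3}(odd_double_half m); case: (odd m); [right|left].
- by rewrite half_double (leq_trans (central_bin_bound p)) // -mul2n expnM.
- have := central_bin_bound p.+1; rewrite doubleS binS.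
  have -> : 'C(p.*2.+1, p.+1) = 'C(p.*2.+1, p).
    by rewrite -bin_sub; [congr 'C(_, _); lia | lia].
  have -> : p.*2.+1./2 = p by lia.
  have <- : 4 * 4 ^ p.*2.+1 = 16 ^ p.+1 by rewrite -expnS -doubleS -mul2n expnM.
  rewrite addnn -mul2n expnMn; nia.
Qed.

(** A pair [(P, i)] stands for the edge from [P] to [i |: P]. Each [P] gets one edge upwards, along
    its chain when it is not the top. These edges reach every set except possibly the bottoms of
    chains, which get one extra edge each. *)
Lemma cube_edges m : exists E : seq ({set 'I_m} * 'I_m),
  [/\ size E <= 2 ^ m + 'C(m, m./2),
      forall P, P != [set: 'I_m] -> exists2 i, i \notin P & (P, i) \in E
    & forall P, P != set0 -> exists2 i, i \in P & (P :\ i, i) \in E].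
Proof.
case: m => [|m].
  exists [::]; split=> // P; case/negP.
    by apply/eqP/setP => -[].
  by apply/eqP/setP => -[].
pose D := [set P : {set 'I_m.+1} | 0 < unmatched (word P)].
pose r (P : {set 'I_m.+1}) : 'I_m.+1 := inord (raise_pos (word P)).
have rE P : P \in D -> r P = raise_pos (word P) :> nat.
  rewrite inE => /raise_pos_lt; rewrite size_word => lt.
  by rewrite /r inordK.
have rP P : P \in D -> r P \notin P.
  move=> PD; rewrite -nth_word rE // nth_raise_pos //.
  by rewrite inE in PD.
pose up P := r P |: P.
have upE P : P \in D -> word (up P) = raise (word P).
  move=> PD; apply: (@eq_from_nth _ false).
    rewrite size_set_nth !size_word; move: (ltn_ord (r P)); rewrite rE //.
    by move/maxn_idPr.
  rewrite size_word => i im; rewrite nth_set_nth /=.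
  rewrite -[i]/(val (Ordinal im)) !nth_word !inE -rE //.
have up_inj : {in D &, injective up}.
  move=> P Q PD QD PQ; apply: word_inj; apply: raise_inj; rewrite ?inE.
  - by rewrite inE in PD.
  - by rewrite inE in QD.
  - by rewrite -!upE // PQ.
(* The defaults are harmless: on the full set [out] gives a degenerate edge, whose conjunction will
   be contradictory, and on [set0] [dn] gives an edge starting at [set0], which the DNF discards. *)
pose out P : 'I_m.+1 := if P \in D then r P else odflt ord0 [pick i | i \notin P].
pose dn (P : {set 'I_m.+1}) : 'I_m.+1 := odflt ord0 [pick i | i \in P].
pose W : seq {set 'I_m.+1} := enum {set 'I_m.+1}.
have sizeW : size W = 2 ^ m.+1.
  by rewrite /W -cardE -cardsT -powersetT card_powerset cardsT card_ord.
exists ([seq (P, out P) | P <- W] ++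
        [seq (P :\ dn P, dn P) | P <- enum (~: (up @: D))]); split.
- rewrite size_cat; apply: leq_add; rewrite size_map; first exact: eq_leq.
  rewrite -cardE.
  (* As [up] is injective on [D], there are as many bottoms as tops. *)
  have -> : 'C(m.+1, m.+1./2) = #|~: D|.
    have := count_unmatched m.+1 0; rewrite subn0 leq0n => <-; rewrite -card_word.
    by apply: eq_card => P; rewrite !inE lt0n negbK.
  by rewrite [leqLHS]cardsCs [leqRHS]cardsCs !setCK card_in_imset.
- move=> P PT; exists (out P); last by rewrite mem_cat map_f ?mem_enum.
  rewrite /out; case: ifP => [/rP //|_]; case: pickP => //= none.
  by case/negP: PT; apply/eqP/setP => i; rewrite in_setT; move/negbFE: (none i).
- move=> P P0; case: (boolP (P \in up @: D)) => [/imsetP [Q QD ->]|nP].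
    exists (r Q); first by rewrite setU11.
    rewrite /up setU1K ?rP // mem_cat; apply/orP; left; apply/mapP; exists Q.
      by rewrite mem_enum.
    by rewrite /out QD.
  exists (dn P).
    rewrite /dn; case: pickP => //= none.
    by case/negP: P0; apply/eqP/setP => i; rewrite inE none.
  rewrite mem_cat; apply/orP; right; apply/mapP; exists P => //.
  by rewrite mem_enum inE.
Qed.

(** * Second moment of the size of a subset *)

Lemma sum_sqr_words m :
  (\sum_(w <- words m) ((count id w).*2%:R - m%:R) ^+ 2 = (m * 2 ^ m)%:R :> int)%R.
Proof.
elim: m => [|m IH]; first by rewrite /= big_seq1.
rewrite /= big_cat /= !big_map -big_split /=.
(* A new letter changes the deviation [a] to [a + 1] or [a - 1], and the two squares add up to
   [2 a ^ 2 + 2]. *)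
rewrite (eq_bigr (fun w => (((count id w).*2%:R - m%:R) ^+ 2 *+ 2 + 2 : int)%R)).
  rewrite big_split /= sumrMnl IH big_const_seq count_predT size_words iter_addr addr0.
  rewrite expnS; lia.
move=> w _; rewrite addnC /= !add0n; lia.
Qed.

(** Chebyshev's inequality: [|X| >= 2k/3] forces [9 (2 |X| - k) ^ 2 >= k ^ 2], while the sum of the
    left sides over all [X] is [9 k 2 ^ k]. *)
Lemma card_large_sets k :
  #|[set X : {set 'I_k} | 2 * k <= 3 * #|X|]| * k <= 9 * 2 ^ k.
Proof.
have -> : #|[set X : {set 'I_k} | 2 * k <= 3 * #|X|]| =
    count (fun w => 2 * k <= 3 * count id w) (words k).
  rewrite -card_word; apply: eq_card => X; rewrite !inE; congr (_ <= 3 * _).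
  by rewrite count_map cardE size_filter -enumT; apply: eq_count.
case: k => [|k]; first by rewrite muln0.
set c := count _ _.
have : ((c * k.+1 ^ 2)%:R <= \sum_(w <- words k.+1)
    9 * ((count id w).*2%:R - k.+1%:R) ^+ 2 :> int)%R.
  rewrite /c -sum1_count big_distrl /= natr_sum big_mkcond /=.
  by apply: ler_sum => w _; case: ifP => h; [nia | nia].
rewrite -mulr_sumr sum_sqr_words => h.
rewrite -(leq_pmul2r (ltn0Sn k)); lia.
Qed.

(** * Variables as nonempty subsets *)

(** Comparing with the first zero makes a column and its complement indistinguishable: a constant
    column gives [set0], and two columns give the same set exactly when they are equal or
    complementary. *)
Definition column_set n m (z : 'I_m.+1 -> 'rV[bool]_n) (i : 'I_n) : {set 'I_m} :=
  [set s | z (lift ord0 s) ord0 i != z ord0 ord0 i].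

Definition zero_rows n m (f : boolfun n) (z : 'I_m.+1 -> 'rV[bool]_n) : Prop :=
  [/\ n = 2 ^ m - 1,
      forall x, ~~ f x <-> exists r, x = z r,
      forall i, column_set z i != set0
    & injective (column_set z)].

Lemma complete_zero_rows k n (f : boolfun n) : complete k f ->
  exists m (z : 'I_m.+1 -> 'rV[bool]_n), zero_rows f z.
Proof.
case=> -[M0 M1 Meq Mneg] kE k0 nE.
case: k kE k0 nE => // m kE _; rewrite subSS subn0 => nE.
pose z (r : 'I_m.+1) : 'rV[bool]_n := enum_val (cast_ord (esym kE) r).
have zM r : enum_val r = z (cast_ord kE r) by rewrite /z cast_ordK.
have colE i j (b : bool) : (forall r, z r ord0 i = b (+) z r ord0 j) ->
    col i (zero_matrix f) = map_mx (addb b) (col j (zero_matrix f)).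
  by move=> h; apply/matrixP => r c; rewrite !mxE zM h.
have split_row (p : pred 'I_m.+1) : p ord0 -> (forall s, p (lift ord0 s)) -> forall r, p r.
  by move=> p0 pl r; case: (unliftP ord0 r) => [s ->|->].
exists m, z; split=> //.
- move=> x; split=> [fx|[r ->]].
    have xz : x \in zeros f by rewrite inE.
    exists (cast_ord kE (enum_rank_in xz x)).
    by rewrite /z cast_ordK enum_rankK_in.
  by have := enum_valP (cast_ord (esym kE) r); rewrite inE.
- move=> i; apply/eqP => /setP c0.
  have zi : forall r, z r ord0 i == z ord0 ord0 i.
    by apply: split_row => // s; have := c0 s; rewrite !inE => /negbFE.
  suff E : col i (zero_matrix f) = const_mx (z ord0 ord0 i).
    by case: (z ord0 ord0 i) E; [apply: M1 | apply: M0].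
  by apply/matrixP => r c; rewrite !mxE zM; apply/eqP/zi.
- move=> i j /setP cij; apply/eqP/negPn/negP => /eqP ij.
  pose b := z ord0 ord0 i (+) z ord0 ord0 j.
  have zb : forall r, z r ord0 i == b (+) z r ord0 j.
    apply: split_row => [|s]; first by rewrite /b; do 2 case: (z _ _ _).
    by have := cij s; rewrite !inE /b; do 4 case: (z _ _ _).
  have := colE i j b (fun r => eqP (zb r)); case: b {zb} => E.
    exact: (Mneg _ _ ij).
  apply: (Meq _ _ ij); rewrite E; apply/matrixP => r c; rewrite !mxE; exact: addFb.
Qed.

(** An injection of [2 ^ m - 1] variables into the [2 ^ m - 1] nonempty subsets is onto. *)
Lemma column_set_surj n m (f : boolfun n) (z : 'I_m.+1 -> 'rV[bool]_n) :
  zero_rows f z -> forall P, P != set0 -> exists i, column_set z i = P.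
Proof.
case=> nE _ c0 cinj P P0.
suff /setP/(_ P) : column_set z @: [set: 'I_n] = [set~ set0].
  by rewrite !inE P0 => /imsetP [i _ ->]; exists i.
apply/eqP; rewrite eqEcard; apply/andP; split.
  by apply/subsetP => _ /imsetP [i _ ->]; rewrite !inE.
rewrite card_imset // cardsT card_ord cardsC1 nE.
by rewrite -cardsT -powersetT card_powerset cardsT card_ord subn1.
Qed.

Lemma zero_row_entry n m (z : 'I_m.+1 -> 'rV[bool]_n) r i :
  z r ord0 i = z ord0 ord0 i (+)
    (if unlift ord0 r is Some s then s \in column_set z i else false).
Proof.
case: unliftP => [s ->|->]; last by rewrite addbF.
by rewrite inE; do 2 case: (z _ _ _).
Qed.

(** * The upper bound *)

(** The last three hypotheses say that [y] falsifies every conjunction of the DNF. At most one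
    singleton [[set r]] is true. A true [P] without true singletons would stay true down the edges
    of [Edn] until a singleton is reached ([down]). If [[set r]] is true, truth descends from the
    full set to every [P] containing [r], along the edges of [Eup] ([up]). *)
Lemma point_of_edges m (E : seq ({set 'I_m} * 'I_m)) (y : {set 'I_m} -> bool) :
  (forall P, P != [set: 'I_m] -> exists2 i, i \notin P & (P, i) \in E) ->
  (forall P, P != set0 -> exists2 i, i \in P & (P :\ i, i) \in E) ->
  (forall i j, i != j -> y [set i] -> ~~ y [set j]) ->
  (forall i, y [set i] -> y [set: 'I_m]) ->
  (forall P i, P != set0 -> (P, i) \in E -> y (i |: P) -> y P || y [set i]) ->
  (forall P, P != set0 -> ~~ y P) \/
  exists r, forall P, P != set0 -> y P = (r \in P).
Proof.
move=> Eup Edn y1 yT yE.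
have down P : P != set0 -> (forall i, i \in P -> ~~ y [set i]) -> ~~ y P.
  have [k] := ubnP #|P|; elim: k P => // k IH P; rewrite ltnS => Pk P0 yP.
  have [i iP iE] := Edn P P0; apply/negP => yPt.
  case: (eqVneq (P :\ i) set0) => [Pi0|Pi0].
    by case/negP: (yP i iP); rewrite -(setD1K iP) Pi0 setU0 in yPt.
  have := yE _ _ Pi0 iE; rewrite setD1K // => /(_ yPt); rewrite (negbTE (yP i iP)) orbF.
  apply/negP/IH => //; first by rewrite (cardsD1 i) iP in Pk.
  by move=> j /setD1P [_]; apply: yP.
have up r (P : {set _}) : y [set r] -> r \in P -> y P.
  move=> yr; have [k] := ubnP #|~: P|; elim: k P => // k IH P; rewrite ltnS => Pk rP.
  case: (eqVneq P [set: 'I_m]) => [->|PT]; first exact: yT yr.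
  have [i iP iE] := Eup P PT.
  have P0 : P != set0 by apply/set0Pn; exists r.
  have ri : r != i by apply: contraNneq iP => <-.
  have := yE _ _ P0 iE; rewrite (negbTE (y1 _ _ ri yr)) orbF; apply.
  apply: IH; last by rewrite setU1r.
  apply: leq_trans Pk; apply/proper_card; rewrite properC; apply/properP.
  split; first exact: subsetU1.
  by exists i; rewrite ?setU11.
case: (pickP (fun r => y [set r])) => [r yr|none]; [right|left].
  exists r => P P0; case: (boolP (r \in P)) => [/up->//|rP].
  apply/negbTE/down => // i iP; apply: (y1 r) => //.
  by apply: contraNneq rP => ->.
by move=> P P0; apply: down => // i _; rewrite none.
Qed.

Lemma complete_dnf n m (f : boolfun n) (z : 'I_m.+1 -> 'rV[bool]_n) :
  0 < n -> zero_rows f z ->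
  exists d : dnf n, [/\ realizes d f,
    dnf_length d <= m ^ 2 + m + (2 ^ m + 'C(m, m./2))
  & dnf_rank d <= 2 * (m ^ 2 + m) + 3 * (2 ^ m + 'C(m, m./2))].
Proof.
move=> n0 zP; have [nE fz c0 cinj] := zP.
have [E [sizeE Eup Edn]] := cube_edges m.
have [v vP] : exists v : {set 'I_m} -> 'I_n, forall P, P != set0 -> column_set z (v P) = P.
  apply: (fin_all_exists (P := fun P i => P != set0 -> column_set z i = P)) => P.
  case: (eqVneq P set0) => [_|/(column_set_surj zP) [i]]; last by exists i.
  by exists (Ordinal n0).
(* Coordinates relative to the first zero: [y x P] tells whether [x] differs from it at the variable
   of [P]. The value [v set0] is arbitrary. *)
pose y (x : 'rV[bool]_n) P := x ord0 (v P) (+) z ord0 ord0 (v P).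
pose lit P b : literal n := (v P, b (+) z ord0 ord0 (v P)).
have litE x P b : eval_literal x (lit P b) = (y x P == b).
  by rewrite /eval_literal /lit /y /=; case: b; do 2 case: (_ ord0 _).
have yz r (P : {set 'I_m}) : P != set0 ->
    y (z r) P = if unlift ord0 r is Some s then s \in P else false.
  by move=> P0; rewrite /y zero_row_entry vP // addbC addKb.
pose d1 := [seq [:: lit [set p.1] true; lit [set p.2] true]
           | p <- enum [pred p : 'I_m * 'I_m | p.1 != p.2]].
pose d2 := [seq [:: lit [set r] true; lit [set: 'I_m] false] | r <- enum 'I_m].
pose d3 := [seq [:: lit (e.2 |: e.1) true; lit e.1 false; lit [set e.2] false]
           | e <- E & e.1 != set0].
exists (d1 ++ d2 ++ d3).
have size1 : size d1 <= m ^ 2.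
  rewrite size_map -cardE (leq_trans (max_card _)) //.
  by rewrite card_prod card_ord mulnn.
have size2 : size d2 = m by rewrite size_map size_enum_ord.
have size3 : size d3 <= 2 ^ m + 'C(m, m./2).
  by rewrite size_map size_filter (leq_trans (count_size _ _)).
split; last 2 first.
- by rewrite /dnf_length !size_cat size2 addnA !leq_add.
- have rankE s (e : dnf n) : all (fun c => size c == s) e -> dnf_rank e = s * size e.
    move=> /allP es; rewrite /dnf_rank (eq_big_seq (fun=> s)) => [|c /es /eqP //].
    by rewrite big_const_seq count_predT iter_addn_0.
  have -> : dnf_rank (d1 ++ d2 ++ d3) = dnf_rank d1 + dnf_rank d2 + dnf_rank d3.
    by rewrite /dnf_rank !big_cat /= addnA.
  rewrite (rankE 2 d1) ?(rankE 2 d2) ?(rankE 3 d3) ?size2 -?mulnDr;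
    do ?by apply/allP => c /mapP [? _ ->].
  by rewrite leq_add // leq_mul // leq_add.
(* First, a point falsifying all conjunctions is a zero, by [point_of_edges]; then each zero
   falsifies all conjunctions. *)
move=> x; apply: negb_inj; apply/idP/idP.
- rewrite /eval_dnf !has_cat !negb_or => /and3P [/hasPn h1 /hasPn h2 /hasPn h3].
  have e1 i j : i != j -> y x [set i] -> ~~ y x [set j].
    move=> ij; have := h1 _ (map_f _ (_ : (i, j) \in _)); rewrite mem_enum => /(_ ij).
    by rewrite /= !litE !eqb_id andbT negb_and; case: (y x [set i]).
  have e2 i : y x [set i] -> y x [set: 'I_m].
    have := h2 _ (map_f _ (_ : i \in _)); rewrite mem_enum => /(_ isT).
    by rewrite /= !litE !eqb_id eqbF_neg andbT negb_and negbK; case: (y x [set i]).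
  have e3 (P : {set _}) i : P != set0 -> (P, i) \in E ->
      y x (i |: P) -> y x P || y x [set i].
    move=> P0 iE; have := h3 _ (map_f _ (_ : (P, i) \in _)).
    rewrite mem_filter P0 iE => /(_ isT); rewrite /= !litE !eqb_id !eqbF_neg andbT.
    by rewrite !negb_and !negbK; case: (y x (i |: P)).
  have xz r : (forall P, P != set0 -> y x P = y (z r) P) -> ~~ f x.
    move=> yxz; apply/fz; exists r; apply/rowP => i.
    have := yxz _ (c0 i); rewrite /y.
    have -> : v (column_set z i) = i by apply/cinj/vP.
    by move/(can_inj (addbK _)).
  case: (point_of_edges Eup Edn e1 e2 e3) => [yx|[r yx]].
    by apply: (xz ord0) => P /yx /negbTE ->; rewrite /y addbb.
  by apply: (xz (lift ord0 r)) => P P0; rewrite yx // yz // liftK.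
- move=> /fz [r ->]; have {}yz := yz r; move: (unlift ord0 r) yz => q yz.
  have s0 (i : 'I_m) : [set i] != set0 by apply/set0Pn; exists i; rewrite set11.
  rewrite /eval_dnf !has_cat !negb_or; apply/and3P; split; apply/hasPn => c /mapP.
  + case=> -[i j]; rewrite mem_enum /= => ij ->; rewrite /= !litE !yz // !eqb_id.
    case: q {yz} => // s; rewrite !inE andbT; apply: contra ij.
    by move=> /andP [/eqP <- /eqP <-].
  + case=> i _ ->; rewrite /= !litE yz //; case: q yz => //= s yz.
    rewrite yz ?inE ?andbF //; by apply/set0Pn; exists i.
  + case=> -[P i]; rewrite mem_filter /= => /andP [P0 _] ->; rewrite /= !litE !yz //.
      by case: q {yz} => // s; rewrite !inE; case: (s == i); case: (s \in P).
    by apply/set0Pn; exists i; rewrite setU11.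
Qed.

(** * The lower bounds *)

Definition flip n (x : 'rV[bool]_n) (i : 'I_n) : 'rV[bool]_n :=
  \row_j (x ord0 j (+) (j == i)).

(** Otherwise two zeros would differ in the single variable [i]. But two zeros are separated by at
    least two subsets: two singletons, or a singleton and the full set if one of them is the first
    zero. The latter two are distinct because [1 < m]. *)
Lemma flip_zero_row n m (f : boolfun n) (z : 'I_m.+1 -> 'rV[bool]_n) r i :
  1 < m -> zero_rows f z -> f (flip (z r) i).
Proof.
move=> m1 zP; have [nE fz c0 cinj] := zP.
apply/negPn/negP => /fz [s /rowP fs].
have {}fs j : (z s ord0 j != z r ord0 j) = (j == i).
  by rewrite -fs mxE; case: (z r ord0 j); case: (j == i).
pose e (t : 'I_m.+1) (P : {set 'I_m}) :=
  if unlift ord0 t is Some a then a \in P else false.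
have eP P : P != set0 -> e s P != e r P -> P = column_set z i.
  move=> P0; have [j <-] := column_set_surj zP P0; move=> esr.
  congr (column_set z _); apply/eqP; rewrite -fs (zero_row_entry z s) (zero_row_entry z r).
  by apply: contra esr => /eqP/addbI E; apply/eqP.
have s0 (a : 'I_m) : [set a] != set0 by apply/set0Pn; exists a; rewrite set11.
suff [P [Q [P0 Q0 PQ [eP1 eQ1]]]] : exists P Q : {set 'I_m},
    [/\ P != set0, Q != set0, P != Q & e s P != e r P /\ e s Q != e r Q].
  by case/eqP: PQ; rewrite (eP P) // (eP Q).
have two (a : 'I_m) : [set a] != [set: 'I_m].
  apply/eqP => /(congr1 (fun X : {set _} => #|X|)).
  by rewrite cards1 cardsT card_ord => m1E; rewrite -m1E in m1.
have T0 (a : 'I_m) : [set: 'I_m] != set0 by apply/set0Pn; exists a.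
have sr : s != r by apply/eqP => sr; have := fs i; rewrite sr !eqxx.
rewrite /e; case: (unliftP ord0 s) => [a sE|sE]; case: (unliftP ord0 r) => [b rE|rE].
- have ab : a != b by apply: contraNneq sr => ab; rewrite sE rE ab.
  have ab1 : [set a] != [set b] by apply: contraNneq ab => /set1_inj ->.
  by exists [set a], [set b]; rewrite !inE !eqxx (eq_sym b) (negbTE ab).
- by exists [set a], [set: 'I_m]; rewrite !inE eqxx (T0 a).
- by exists [set b], [set: 'I_m]; rewrite !inE eqxx (T0 b).
- by rewrite sE rE eqxx in sr.
Qed.

Definition truth_set n m (z : 'I_m.+1 -> 'rV[bool]_n) (l : literal n) : {set 'I_m.+1} :=
  [set r | eval_literal (z r) l].

Definition negate n (l : literal n) : literal n := (l.1, ~~ l.2).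

Lemma eval_literalE n (x : 'rV[bool]_n) (l : literal n) :
  eval_literal x l = (x ord0 l.1 == l.2).
Proof. by case: l => i [] /=; rewrite /eval_literal /=; case: (x _ _). Qed.

Lemma truth_set_negate n m (z : 'I_m.+1 -> 'rV[bool]_n) l :
  truth_set z (negate l) = ~: truth_set z l.
Proof. by apply/setP => r; rewrite !inE !eval_literalE /=; case: l.2; case: (z _ _ _). Qed.

(** Equal truth sets give equal column sets, hence the same variable; the first zero then fixes the
    sign. *)
Lemma truth_set_inj n m (f : boolfun n) (z : 'I_m.+1 -> 'rV[bool]_n) :
  zero_rows f z -> injective (truth_set z).
Proof.
case=> _ _ _ cinj [i b] [j c] /setP E.
have {}E r : (z r ord0 i == b) = (z r ord0 j == c).
  by have := E r; rewrite !inE !eval_literalE.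
have ij : i = j.
  apply: cinj; apply/setP => s; rewrite !inE; move: (E ord0) (E (lift ord0 s)).
  by case: b {E}; case: c; do 4 case: (z _ _ _).
rewrite -{j}ij in E *; congr (_, _); move: (E ord0).
by case: b {E}; case: c; case: (z _ _ _).
Qed.

Lemma truth_set_neq0 n m (f : boolfun n) (z : 'I_m.+1 -> 'rV[bool]_n) l :
  zero_rows f z -> truth_set z l != set0.
Proof.
case=> _ _ c0 _; have /set0Pn [s] := c0 l.1; rewrite inE => zs.
have : (ord0 \in truth_set z l) || (lift ord0 s \in truth_set z l).
  by rewrite !inE !eval_literalE; move: zs; case: l.2; do 2 case: (z _ _ _).
by case/orP => h; apply/set0Pn; [exists ord0 | exists (lift ord0 s)].
Qed.

Lemma conjunction_false_at_zero n m (f : boolfun n) (z : 'I_m.+1 -> 'rV[bool]_n)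
    (d : dnf n) c r : zero_rows f z -> realizes d f -> c \in d ->
  exists2 l, l \in c & r \notin truth_set z l.
Proof.
case=> _ fz _ _ df cd; have /fz : exists q, z r = z q by exists r.
by rewrite -df => /hasPn /(_ c cd) /allPn [l lc lz]; exists l; rewrite ?inE.
Qed.

(* Every false literal at a zero is the only reason why some conjunction fails
   there, since flipping its variable leaves the set of zeros. *)
Lemma sensitive_conjunction n m (f : boolfun n) (z : 'I_m.+1 -> 'rV[bool]_n)
    (d : dnf n) l r : 1 < m -> zero_rows f z -> realizes d f ->
  r \notin truth_set z l ->
  exists c, [/\ c \in d, l \in c, negate l \notin c
              & forall l', l' \in c -> l' != l -> r \in truth_set z l'].
Proof.
move=> m1 zP df rl.
have := flip_zero_row r l.1 m1 zP; rewrite -df => /hasP [c cd /allP cx].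
have only l' : l' \in c -> r \notin truth_set z l' -> l' = l.
  move=> /cx; move: rl; rewrite !inE !eval_literalE mxE.
  case: l l' {cx} => i b [j e] /=; case: (eqVneq j i) => [->|_].
    by case: b; case: e; case: (z _ _ _).
  by rewrite addbF => _ ->.
have [l0 l0c l0r] := conjunction_false_at_zero r zP df cd.
have lc : l \in c by rewrite -(only _ l0c l0r).
exists c; split=> //.
  apply/negP => /cx; move: (cx _ lc); rewrite !eval_literalE /=.
  by move=> /eqP ->; case: l.2.
by move=> l' l'c; apply: contraR => /(only _ l'c) ->.
Qed.

Lemma complete_length_lower n m (f : boolfun n) (z : 'I_m.+1 -> 'rV[bool]_n) (d : dnf n) :
  1 < m -> zero_rows f z -> realizes d f -> n <= dnf_length d.
Proof.
move=> m1 zP df; pose l i : literal n := (i, ~~ z ord0 ord0 i).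
have l0 i : ord0 \notin truth_set z (l i).
  by rewrite inE eval_literalE /=; case: (z _ _ _).
have [c cP] := fin_all_exists (fun i => sensitive_conjunction m1 zP df (l0 i)).
rewrite -[leqLHS]size_enum_ord -(size_map c); apply: uniq_leq_size.
  (* [l i] is the only literal of [c i] that is false at the first zero, so [c] is injective. *)
  rewrite map_inj_uniq ?enum_uniq // => i j cij; have [_ _ _ h] := cP i.
  have [_ ljc _ _] := cP j; rewrite -cij in ljc.
  case: (eqVneq (l j) (l i)) => [[]//|/(h _ ljc)].
  by rewrite (negbTE (l0 j)).
by move=> _ /mapP [i _ ->]; case: (cP i).
Qed.

Lemma count1_unique (T : eqType) (p : pred T) (s : seq T) (a b : T) :
  count p s = 1 -> a \in s -> p a -> b \in s -> p b -> a = b.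
Proof.
rewrite -size_filter => s1 as' pa bs pb.
have : a \in filter p s by rewrite mem_filter pa.
have : b \in filter p s by rewrite mem_filter pb.
by case: (filter p s) s1 => [|x []] // _; rewrite !inE => /eqP -> /eqP ->.
Qed.

Lemma complete_rank_lower n m (f : boolfun n) (z : 'I_m.+1 -> 'rV[bool]_n) (d : dnf n) :
  1 < m -> zero_rows f z -> realizes d f ->
  3 * #|[set l : literal n | 3 * #|truth_set z l| < 2 * m.+1]| <= 2 * dnf_rank d.
Proof.
move=> m1 zP df; set T := [set l | _].
pose V := truth_set z; pose occ (l : literal n) := count (fun c : conjunction n => l \in c) d.
pose S := [set l in T | occ l == 1].
have occ0 l : 0 < occ l.
  have /set0Pn [r] := truth_set_neq0 (negate l) zP.
  rewrite truth_set_negate inE => /(sensitive_conjunction m1 zP df) [c [cd lc _ _]].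
  by rewrite -has_count; apply/hasP; exists c.
(* Since [c] is the only conjunction containing [l], it is the one given by [sensitive_conjunction]
   at every zero where [l] fails. *)
have SP c l : c \in d -> l \in c -> l \in S ->
    negate l \notin c /\ forall l', l' \in c -> l' != l -> ~: V l \subset V l'.
  move=> cd lc; rewrite inE => /andP [_ /eqP l1].
  have uniq_c c' : c' \in d -> l \in c' -> c' = c.
    by move=> c'd lc'; apply: (count1_unique l1).
  split.
    have /set0Pn [r] := truth_set_neq0 (negate l) zP.
    rewrite truth_set_negate inE => /(sensitive_conjunction m1 zP df) [c' [c'd lc' nc' _]].
    by rewrite -(uniq_c c').
  move=> l' l'c l'l; apply/subsetP => r; rewrite inE.
  move=> /(sensitive_conjunction m1 zP df) [c' [c'd lc' _ h]].
  by apply: h => //; rewrite (uniq_c c').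
pose C (c : conjunction n) := [set l in c].
pose t (c : conjunction n) : nat := (C c :&: S != set0).
(* At a zero where [l] holds, [c] fails through some [l1]. As [l1] is not [negate l], its truth set
   strictly contains that of [negate l], so [l] and [l1] hold together at some zero; there [c] fails
   through a third literal. *)
have big3 c : c \in d -> 3 * t c <= #|C c|.
  move=> cd; rewrite /t; case: (eqVneq (C c :&: S) set0) => [//|/set0Pn [l]].
  rewrite !in_setI [l \in C c]inE => /andP [lc lS].
  have [negl sub] := SP c l cd lc lS.
  have /set0Pn [r rl] := truth_set_neq0 l zP.
  have [l1 l1c rl1] := conjunction_false_at_zero r zP df cd.
  have l1l : l1 != l by apply: contraNneq rl1 => ->.
  have /subsetPn [r' r'l1 r'l] : ~~ (V l1 \subset ~: V l).
    apply: contra negl => sub'.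
    suff -> : negate l = l1 by [].
    apply: (truth_set_inj zP); rewrite truth_set_negate; apply/eqP.
    by rewrite eqEsubset sub // sub'.
  have [l2 l2c rl2] := conjunction_false_at_zero r' zP df cd.
  have l2l1 : l2 != l1 by apply: contraNneq rl2 => ->.
  have l2l : l2 != l.
    by apply: contraNneq rl2 => ->; rewrite inE negbK in r'l.
  rewrite muln1; suff <- : #|[set l2; l1; l]| = 3.
    apply: subset_leq_card; apply/subsetP => l'; rewrite !inE.
    by move=> /orP [/orP [] |] /eqP ->.
  by rewrite -setUA cardsU1 cards2 !inE negb_or l2l1 l2l l1l.
(* With two literals of [S] in [c], their sets of failure are disjoint, have more than [(m + 1) / 3]
   elements each, and lie in the truth set of every other literal of [c]. So no other literal is in
   [T], and the claim becomes [2 + 2 <= 3 + 1]. *)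
have small c : c \in d -> #|C c :&: T| + #|C c :&: S| <= #|C c| + t c.
  move=> cd; have [S1|S2] := leqP #|C c :&: S| 1.
    apply: leq_add; first exact/subset_leq_card/subsetIl.
    by rewrite /t -card_gt0; case: #|_ :&: _| S1 => [|[]].
  have [l [l' [lI l'I ll']]] := card_gt1P S2.
  have t1 : t c = 1 by rewrite /t -card_gt0; case: #|_ :&: _| S2.
  move: lI l'I; rewrite !in_setI ![_ \in C c]inE => /andP [lc lS] /andP [l'c l'S].
  have := big3 c cd; rewrite t1 muln1 => C3.
  have CT : C c :&: T \subset [set l; l'].
    apply/subsetP => l2; rewrite in_setI [l2 \in C c]inE => /andP [l2c l2T].
    rewrite !inE; apply/negPn/negP; rewrite negb_or => /andP [l2l l2l'].
    have [_ subl] := SP c l cd lc lS; have [_ subl'] := SP c l' cd l'c l'S.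
    have sub2 : ~: V l :|: ~: V l' \subset V l2 by rewrite subUset subl // subl'.
    have disj : ~: V l :&: ~: V l' = set0.
      by apply/eqP; rewrite setI_eq0 disjoints_subset setCK subl // eq_sym.
    have := subset_leq_card sub2; rewrite cardsU disj cards0 subn0.
    have := cardsC (V l); have := cardsC (V l'); rewrite card_ord.
    move: lS l'S l2T; rewrite !inE => /andP [lT _] /andP [l'T _] l2T.
    by rewrite -/V in lT l'T l2T; lia.
  have ST : S \subset T by apply/subsetP => l2; rewrite inE => /andP [].
  have := subset_leq_card CT; rewrite cards2 ll'.
  have := subset_leq_card (setIS (C c) ST); lia.
have sumI (A : {set literal n}) : \sum_(c <- d) #|C c :&: A| = \sum_(l in A) occ l.
  rewrite (eq_bigr (fun c => \sum_(l in A) (l \in c : nat))); last first.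
    move=> c _; rewrite -sum1_card [RHS]big_mkcond [LHS]big_mkcond.
    by apply: eq_bigr => l _; rewrite !inE; case: (l \in c); case: (l \in A).
  rewrite exchange_big; apply: eq_bigr => l _.
  by rewrite /occ -sum1_count [RHS]big_mkcond; apply: eq_bigr => c _; case: (l \in c).
have rankC : \sum_(c <- d) #|C c| <= dnf_rank d.
  by apply: leq_sum => c _; rewrite cardsE card_size.
have h3 : 3 * \sum_(c <- d) t c <= \sum_(c <- d) #|C c|.
  by rewrite big_distrr /= !big_seq; apply: leq_sum.
(* A literal of [T] occurs at least twice, or once and is then counted again in [S]. *)
have h1 : 2 * #|T| <= \sum_(c <- d) #|C c| + \sum_(c <- d) t c.
  rewrite -big_split /=; apply: leq_trans (_ : \sum_(c <- d) (#|C c :&: T| + #|C c :&: S|) <= _).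
    rewrite big_split /= !sumI [X in _ <= _ + X]big_mkcond [X in _ <= X + _]big_mkcond.
    rewrite -big_split /= -sum1_card big_distrr /= big_mkcond /=.
    apply: leq_sum => l _; rewrite [l \in S]inE; case: (l \in T) => //=.
    by have := occ0 l; case: (occ l) => [|[]].
  by rewrite !big_seq; apply: leq_sum.
lia.
Qed.

(** * Asymptotics *)

(** The error term will be [60 / (loglog n + 1)]: a slow rate, about the inverse of [log m], but one
    that keeps the estimates in natural numbers. *)
Definition loglog (n : nat) : nat := trunc_log 2 (trunc_log 2 n.+1).+1.

Lemma loglog_pow m : loglog (2 ^ m - 1) = trunc_log 2 m.+1.
Proof. by rewrite /loglog -subSn ?expn_gt0 // subn1 trunc_expnK. Qed.

Lemma trunc_log_le_self m : trunc_log 2 m.+1 <= m.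
Proof.
have := trunc_logP (isT : 1 < 2) (ltn0Sn m).
by move/(leq_trans (ltn_expl _ (isT : 1 < 2))).
Qed.

Lemma cube_le_exp m : m.+1 ^ 3 <= 8 * 2 ^ m.
Proof.
elim: m => // m IH; case: (leqP m 2) => [|m3]; first by case: m {IH} => [|[|[]]].
have step : m.+2 ^ 3 <= 2 * m.+1 ^ 3.
  by rewrite -(subnK m3); move: (m - 3) => p; rewrite !expnSr !expn0; lia.
by rewrite (expnS 2); lia.
Qed.

(** Compare squares: [(t + 1) ^ 2 <= 4 * 2 ^ t <= 4 (m + 1)], and the factor [m + 1] is absorbed by
    [middle_bin_bound]. *)
Lemma log_mul_middle_bin m : (trunc_log 2 m.+1).+1 * 'C(m, m./2) <= 2 * 2 ^ m.
Proof.
set t := trunc_log 2 m.+1.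
have t2 : t.+1 ^ 2 <= 4 * 2 ^ t.
  elim: t => // t IH; case: (leqP t 1) => [|t2]; first by case: t {IH} => [|[]].
  have step : t.+2 ^ 2 <= 2 * t.+1 ^ 2 by nia.
  by rewrite (expnS 2); lia.
have tm : 2 ^ t <= m.+1 by apply: trunc_logP.
rewrite -(leq_exp2r _ _ (isT : 0 < 2)) !expnMn -[(2 ^ m) ^ 2]expnM (mulnC m) expnM.
apply: leq_trans (_ : 4 * m.+1 * 'C(m, m./2) ^ 2 <= _).
  by rewrite leq_mul2r; apply/orP; right; apply: leq_trans t2 _; rewrite leq_mul2l.
by rewrite -mulnA leq_mul2l mulnC middle_bin_bound.
Qed.

Lemma complete_dnf_asymptotic n m (f : boolfun n) (z : 'I_m.+1 -> 'rV[bool]_n) :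
  0 < n -> zero_rows f z ->
  exists d : dnf n, [/\ realizes d f,
    (loglog n).+1 * dnf_length d <= (loglog n).+1 * n + 60 * n
  & (loglog n).+1 * dnf_rank d <= (loglog n).+1 * (3 * n) + 60 * n].
Proof.
move=> n0 zP; have [d [df dl dr]] := complete_dnf n0 zP.
have [nE _ _ _] := zP; exists d; split=> //.
all: have tE : loglog n = trunc_log 2 m.+1 by rewrite [in LHS]nE loglog_pow.
all: rewrite tE; have := trunc_log_le_self m.
all: have := cube_le_exp m; have := log_mul_middle_bin m.
all: set t := trunc_log _ _; move=> h1 h2 h3; have e0 : 0 < 2 ^ m by rewrite expn_gt0.
all: set B := 'C(_, _) in h1 dl dr; set e := 2 ^ m in nE e0 h1 h2 dl dr.
all: have h4 : t.+1 * (m ^ 2 + m) <= 8 * e by apply: leq_trans h2; nia.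
all: have h5 : t.+1 <= 8 * e by apply: leq_trans h2; nia.
- apply: leq_trans (leq_mul (leqnn _) dl) _.
  by rewrite !mulnDr; nia.
- apply: leq_trans (leq_mul (leqnn _) dr) _.
  have : t.+1 * (2 * (m ^ 2 + m)) <= 16 * e by nia.
  by nia.
Qed.

Lemma complete_rank_asymptotic n m (f : boolfun n) (z : 'I_m.+1 -> 'rV[bool]_n)
    (d : dnf n) : 1 < m -> zero_rows f z -> realizes d f ->
  (loglog n).+1 * (3 * n) <= (loglog n).+1 * dnf_rank d + 60 * n.
Proof.
move=> m1 zP df; have [nE _ _ _] := zP.
have := complete_rank_lower m1 zP df; set T := [set l | _] => rk.
(* Distinct literals have distinct truth sets, so those outside [T] are at most as many as the large
   subsets of the zeros. *)
have TC : #|~: T| <= #|[set X : {set 'I_m.+1} | 2 * m.+1 <= 3 * #|X|]|.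
  rewrite -(card_imset _ (truth_set_inj zP)); apply: subset_leq_card.
  by apply/subsetP => _ /imsetP [l lT ->]; move: lT; rewrite !inE -leqNgt.
have := cardsC T; rewrite card_prod card_ord card_bool => Tn.
have := card_large_sets m.+1; move: TC; set c := #|_ : {set {set _}}|; move=> TC h.
have tE : loglog n = trunc_log 2 m.+1 by rewrite [in LHS]nE loglog_pow.
have := trunc_log_le_self m; rewrite -tE => tm.
have e1 : 1 < 2 ^ m by rewrite -[1]/(2 ^ 0) ltn_exp2l // ltnW.
rewrite expnS in h; nia.
Qed.

From mathcomp Require Import boolp classical_sets reals topology normedtype sequences.
From mathcomp Require Import lra.
Import numFieldNormedType.Exports.
Local Open Scope classical_set_scope.
Local Open Scope ring_scope.

Lemma loglog_cvg : loglog n @[n --> \oo] --> \oo.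
Proof.
apply/cvgnyPge => A; exists (2 ^ 2 ^ A)%N => // n /= le.
apply: trunc_log_max => //; apply: leqW; apply: trunc_log_max => //; exact: leqW.
Qed.

Lemma natr_le_of_mulSn (R : realFieldType) (q a b c : nat) :
  (q.+1 * a <= q.+1 * b + c)%N -> a%:R <= b%:R + c%:R * q.+1%:R^-1 :> R.
Proof.
move=> h; have q0 : 0 < q.+1%:R :> R by rewrite ltr0n.
rewrite -(ler_pM2l q0) mulrDr mulrCA divff ?gt_eqF // mulr1.
by rewrite -!natrM -natrD ler_nat.
Qed.

Theorem theorem5 (R : realType) :
  exists eps : nat -> R,
    [/\ eps @ \oo --> (0 : R),
        forall (k n : nat) (f : boolfun n), complete k f ->
          exists d : dnf n,
            [/\ realizes d f,
                `| (dnf_rank d)%:R - 3 * n%:R | <= 3 * n%:R * eps n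
              & `| (dnf_length d)%:R - n%:R | <= n%:R * eps n]
      & forall (k n : nat) (f : boolfun n), complete k f ->
          forall d : dnf n, realizes d f ->
            3 * n%:R * (1 - eps n) <= (dnf_rank d)%:R
            /\ n%:R * (1 - eps n) <= (dnf_length d)%:R].
Proof.
pose eps n : R := 60 * (loglog n).+1%:R^-1.
have eps_ge0 n : 0 <= eps n by rewrite mulr_ge0 ?invr_ge0 ?ler0n.
have cE n : (60 * n)%:R * (loglog n).+1%:R^-1 = n%:R * eps n :> R.
  by rewrite natrM /eps mulrCA mulrA.
have lower k n (f : boolfun n) : complete k f -> forall d : dnf n, realizes d f ->
    3 * n%:R * (1 - eps n) <= (dnf_rank d)%:R /\
    n%:R * (1 - eps n) <= (dnf_length d)%:R.
  move=> /complete_zero_rows [m [z zP]] d df; have [nE _ _ _] := zP.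
  have n_ge0 : 0 <= n%:R :> R by rewrite ler0n.
  have ne_ge0 : 0 <= n%:R * eps n by rewrite mulr_ge0.
  have [m1|m1] := leqP m 1.
    have eps1 : 1 <= eps n.
      rewrite /eps ler_pdivlMr ?ltr0n // mul1r ler_nat nE loglog_pow.
      by apply: leq_trans (_ : m.+1 <= _)%N; rewrite ?ltnS ?trunc_log_le_self //; lia.
    have le0 : n%:R * (1 - eps n) <= 0 by rewrite mulr_ge0_le0 // subr_le0.
    split; apply: le_trans (ler0n _ _) => //.
    by rewrite -mulrA mulr_ge0_le0.
  split.
    have := natr_le_of_mulSn R (complete_rank_asymptotic m1 zP df).
    by rewrite cE natrM; lra.
  have := complete_length_lower m1 zP df; rewrite -(ler_nat R); lra.
exists eps; split=> //.
  rewrite -(mulr0 60); apply: cvgMr.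
  exact: (cvg_comp _ _ loglog_cvg (@cvg_harmonic R)).
move=> k n f fk; have [m [z zP]] := complete_zero_rows fk.
(* For [n = 0] the only point is a zero, and the empty DNF has rank and length 0. *)
case: (posnP n) => [n0|n0].
  exists [::]; subst n; rewrite /dnf_rank big_nil /dnf_length /= !mulr0 !mul0r subrr normr0.
  split=> // x; have [_ fz _ _] := zP; apply/esym/negbTE/fz; exists ord0.
  by apply/rowP => -[].
have [d [df dl dr]] := complete_dnf_asymptotic n0 zP; exists d; split=> //.
(* The lower half of each absolute value is the bound valid for every DNF. *)
all: have [lr ll] := lower _ _ _ fk d df.
all: have n_ge0 : 0 <= n%:R :> R by rewrite ler0n.
all: have ne_ge0 : 0 <= n%:R * eps n by rewrite mulr_ge0.
all: rewrite ler_norml.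
- have := natr_le_of_mulSn R dr; rewrite cE natrM => ur.
  by apply/andP; split; lra.
- have := natr_le_of_mulSn R dl; rewrite cE => ul.
  by apply/andP; split; lra.
Qed.
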